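(* Consider a family $\mathcal{O}$ of bounded Lipschitz domains $\Omega\subset\Omega^{\mathrm{ext}}\subset\mathbb{R}^3$ and load spaces $\mathscr{V}_{\mathrm{vol}},\mathscr{V}_{\mathrm{sur}}$ such that for all $f\in\mathscr{V}_{\mathrm{vol}}$, $g\in\mathscr{V}_{\mathrm{sur}}$, $\Omega\in\mathcal{O}$ the mixed problem of linear elasticity has a unique (weak) solution $u=u(\Omega)$, that $u$ and its weak derivative $\nabla u$ are measurable functions, and that the traces of $u$ and $\nabla u$ on $\partial\Omega$ are well defined in the sense of measurable functions. Suppose that, for some $m>1$, $\left\|\frac1{N_{\mathrm{det}}(\nabla u)}\right\|_{L^m(\partial\Omega)}<\infty$ for all $f\in\mathscr{V}_{\mathrm{vol}}$, $g\in\mathscr{V}_{\mathrm{sur}}$ and $\Omega\in\mathcal{O}$. Consider the local probabilistic Weibull model for LCF with parameter $m$, i.e. $\varrho_{\mathrm{vol}}=0$ and $\varrho_{\mathrm{sur}}(t,\nabla u)=\frac{m}{N_{\mathrm{det}}(\nabla u)}\left(\frac{t}{N_{\mathrm{det}}(\nabla u)}\right)^{m-1}$, with time axis $\mathscr{T}=[0,\infty)$. Then: (i) The model induces a first order local crack initiation model, i.e. the associated measures $\rho_\Omega$ are Radon measures on $\mathscr{T}\times\Omega^{\mathrm{ext}}$. (ii) The intensities of this model are $0$-regular, i.e. are continuous functions of $\nabla u$. (iii) The crack initiation time $T_\Omega$ is Weibull distributed with shape parameter $m$ and scale parameter $\eta=\left\|\frac1{N_{\mathrm{det}}(\nabla 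u)}\right\|_{L^m(\partial\Omega)}^{-1}$.
   Context: Mixed problem of linear elasticity: $\partial\Omega=\partial\Omega_D\cup\partial\Omega_N$ is a partition, $\nu$ the outward normal, $\lambda,\mu>0$ the Lamé coefficients, and $u:\Omega\to\mathbb{R}^3$ solves $\nabla\cdot\sigma(u)+f=0$ in $\Omega$, $\sigma(u)=\lambda(\nabla\cdot u)I+\mu(\nabla u+\nabla u^T)$, $u=0$ on $\partial\Omega_D$, $\sigma(u)\nu=g$ on $\partial\Omega_N$. The loads $f,g$ are independent of time. Local crack initiation model of order 1: with $\mathscr{C}^{\mathrm{ext}}=\mathscr{T}\times\Omega^{\mathrm{ext}}$ ($\Omega^{\mathrm{ext}}$ bounded and containing $\overline\Omega$ for $\Omega\in\mathcal{O}$), and measurable intensity functions $\varrho_{\mathrm{vol}},\varrho_{\mathrm{sur}}\ge0$, $\gamma_\Omega$ is the Poisson point process on $\mathscr{C}^{\mathrm{ext}}$ with intensity measure $$\rho_\Omega(B)=\int_{B\cap(\mathscr{T}\times\Omega)}\varrho_{\mathrm{vol}}(t,x,u,\nabla u)\,dt\,dx+\int_{B\cap(\mathscr{T}\times\partial\Omega)}\varrho_{\mathrm{sur}}(t,x,u,\nabla u)\,dt\,dA,\quad B\subseteq\mathscr{C}^{\mathrm{ext}}\text{ Borel},$$ provided $\rho_\Omega$ is a Radon measure, meaning finite on bounded Borel sets. The crack initiation time is $T_\Omega=\inf\{t>0:\gamma_\Omega(\mathscr{C}^{\mathrm{ext}}_t)>0\}$ with $\mathscr{C}^{\mathrm{ext}}_t=\{(s,x)\in\mathscr{C}^{\mathrm{ext}}:s\le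 t\}$. Definition of $N_{\mathrm{det}}$. Let $K,n'>0$, $E=\frac{\mu(3\lambda+2\mu)}{\lambda+\mu}$, $\sigma_f',\varepsilon_f'>0$, $b,c<0$. Let $\mathrm{RO}(s)=\frac sE+\left(\frac sK\right)^{1/n'}$; let $\mathrm{SD}(\sigma_v)$ be the positive solution $s$ of $\frac{\sigma_v^2}{E}=\frac{s^2}{E}+s\left(\frac sK\right)^{1/n'}$; let $\mathrm{CMB}(N)=\frac{\sigma_f'}{E}(2N)^b+\varepsilon_f'(2N)^c$; and $\varphi=\mathrm{CMB}^{-1}\circ\mathrm{RO}\circ\mathrm{SD}:(0,\infty)\to(0,\infty)$, extended by $\varphi(0)=\infty$. For a symmetric matrix $\sigma$ put $\sigma'=\sigma-\frac13\mathrm{tr}(\sigma)I$ and $[\sigma]_v=\sqrt{\frac32\mathrm{tr}(\sigma'^2)}$. For $M\in\mathbb{R}^{3\times3}$, $N_{\mathrm{det}}(M)=\varphi([\lambda\,\mathrm{tr}(M)I+\mu(M+M^T)]_v)\in(0,\infty]$, with the convention $\frac1\infty=0$. The Weibull distribution with scale $\eta$ and shape $m$ has distribution function $F(t)=1-e^{-(t/\eta)^m}$ for $t>0$ and $0$ otherwise; in the degenerate case $\|1/N_{\mathrm{det}}(\nabla u)\|_{L^m(\partial\Omega)}=0$ one reads $\eta=\infty$, $F\equiv0$ on $[0,\infty)$, i.e. $T_\Omega=\infty$ almost surely. *)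

(* Defs.v *)
From HB Require Import structures.
From mathcomp Require Import all_boot all_order all_algebra.
From mathcomp Require Import all_classical all_reals all_analysis.
From mathcomp Require Import measurable_realfun.
Set Implicit Arguments.
Unset Strict Implicit.
Unset Printing Implicit Defensive.
Import Order.TTheory GRing.Theory Num.Theory.
Import numFieldNormedType.Exports.
Local Open Scope classical_set_scope.
Local Open Scope ring_scope.

(* Borel sigma-algebra of the space of matrices *)
HB.instance Definition _ (R : realType) (m n : nat) :=
  @isMeasurable.Build (sigma_display (@open 'M[R]_(m, n))) 'M[R]_(m, n)
    <<s (@open 'M[R]_(m, n)) >>
    (@sigma_algebra0 _ setT (@open 'M[R]_(m, n)))
    (@sigma_algebraC _ (@open 'M[R]_(m, n)))
    (@sigma_algebra_bigcup _ setT (@open 'M[R]_(m, n))).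

Section borel_matrix.
Context {R : realType} {m n : nat}.

Lemma open_measurable_mx (A : set 'M[R]_(m, n)) : open A -> measurable A.
Proof. exact: sub_gen_smallest. Qed.

Lemma closed_measurable_mx (A : set 'M[R]_(m, n)) : closed A -> measurable A.
Proof.
move=> Ac; rewrite -(setCK A); apply: measurableC; apply: open_measurable_mx.
exact: closed_openC.
Qed.

Lemma open_mx_bigcup (A : set 'M[R]_(m, n)) : open A ->
  A = \bigcup_(p : 'M[rat]_(m, n) * nat)
    [set x | ball (map_mx ratr p.1 : 'M[R]_(m, n)) p.2.+1%:R^-1 `<=` A /\
       forall i j, ball (ratr (p.1 i j) : R) p.2.+1%:R^-1 (x i j)].
Proof.
move=> Ao; apply/seteqP; split=> x.
- move=> Ax; have /nbhs_ballP[e /= e0 xeA] : nbhs x A by exact: open_nbhs_nbhs.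
  have [k /= ke] : exists k : nat, k.+1%:R^-1 < e / 2.
    have /ltr_add_invr[k] : 0 < e / 2 by rewrite divr_gt0.
    by rewrite add0r => ke; exists k.
  have qx i j : exists q : rat, `|ratr q - x i j| < k.+1%:R^-1.
    have [q] : exists q, ratr q \in `]x i j, x i j + k.+1%:R^-1[.
      by apply: rat_in_itvoo; rewrite ltrDl invr_gt0.
    rewrite in_itv /= => /andP[q1 q2]; exists q.
    by rewrite ger0_norm ?subr_ge0 ?(ltW q1)// ltrBlDl.
  pose q := \matrix_(i < m, j < n) projT1 (cid (qx i j)) : 'M[rat]_(m, n).
  have qE i j : `|ratr (q i j) - x i j| < k.+1%:R^-1.
    by rewrite mxE; case: cid.
  exists (q, k) => //=; split=> [y [_ qy]|i j]; last exact: qE.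
  apply: xeA; split=> // i j; have := qy i j; rewrite mxE /ball /= => qyij.
  rewrite (splitr e) (le_lt_trans (ler_distD (ratr (q i j)) _ _))// ltrD//.
    by rewrite distrC (lt_trans (qE i j)).
  by rewrite (lt_trans qyij).
- by case=> -[q k] _ /= [qkA xq]; apply: qkA; split; [rewrite invr_gt0|move=> i j; rewrite mxE].
Qed.

Lemma measurable_fun_mx d (T : measurableType d) (D : set T)
    (f : T -> 'M[R]_(m, n)) :
  (forall i j, measurable_fun D (fun t => f t i j)) -> measurable_fun D f.
Proof.
move=> mf mD.
apply: (@measurability _ _ _ _ D f (@open 'M[R]_(m, n))) => //.
move=> _ [A Ao <-]; rewrite (open_mx_bigcup Ao) preimage_bigcup setI_bigcupr.
apply: countable_bigcupT_measurable => [|[q k]]; first exact: countableP.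
have [qkA|qkA] := pselect (ball (map_mx ratr q : 'M[R]_(m, n)) k.+1%:R^-1 `<=` A); last first.
  rewrite (_ : _ `&` _ = set0)//; apply/seteqP; split=> // t /=.
  by case=> _ [].
rewrite (_ : _ `&` _ = \bigcap_(p in [set: option ('I_m * 'I_n)])
    (if p is Some p then
      D `&` (fun t => f t p.1 p.2) @^-1` ball (ratr (q p.1 p.2) : R) k.+1%:R^-1
     else D)).
  apply: fin_bigcap_measurable => // -[p _|//].
  by apply: mf => //; exact: measurable_ball.
apply/seteqP; split=> [t [Dt [_ qt]] [p _|//]|t pt] /=; first by split=> //; exact: qt.
split; first exact: (pt None).
by split=> // i j; have [] := pt (Some (i, j)) I.
Qed.

End borel_matrix.
Section euclidean.
Context {R : realType} {n : nat}.
Implicit Types (x y : 'rV[R]_n) (A : set 'rV[R]_n).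

Definition enorm x : R := Num.sqrt (\sum_(i < n) x 0 i ^+ 2).

Definition eball x (r : R) : set 'rV[R]_n := [set y | enorm (y - x) < r].

(* the maximum with 0 gives the empty set diameter 0 instead of -oo *)
Definition ediam A : \bar R :=
  maxe 0%E (ereal_sup [set (enorm (x - y))%:E | x in A & y in A]).

Lemma ediam_ge0 A : (0 <= ediam A)%E.
Proof. by rewrite /ediam le_max lexx. Qed.

Lemma ediam0 : ediam set0 = 0%E.
Proof. by rewrite /ediam image2E setX0 image_set0 ereal_sup0; apply/max_idPl. Qed.

Lemma le_norm_enorm x : `|x| <= enorm x.
Proof.
rewrite [`|x|]mx_normrE; apply: bigmax_le => [|[i j] _]; first exact: sqrtr_ge0.
rewrite /= (ord1 i) -sqrtr_sqr; apply: ler_wsqrtr.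
by rewrite (bigD1 j)//= lerDl sumr_ge0// => k _; exact: sqr_ge0.
Qed.

Lemma norm_le_ediam A x y : A x -> A y -> (`|x - y|%:E <= ediam A)%E.
Proof.
move=> Ax Ay; rewrite /ediam le_max; apply/orP; right.
apply: (@le_trans _ _ (enorm (x - y))%:E); first by rewrite lee_fin le_norm_enorm.
by apply: ereal_sup_ubound; exists x => //; exists y.
Qed.

End euclidean.

Section hausdorff2.
Local Open Scope ereal_scope.
Context {R : realType} {n : nat}.
Implicit Types (A B C X : set 'rV[R]_n).

(* Two-dimensional Hausdorff measure for the Euclidean distance, normalized to
   be the area on C^1 surfaces. [mu_ext] ranges over countable covers by Borel
   sets, which is no restriction since a set and its closure have the same
   diameter; covers with a set of diameter > delta get infinite cost. *)
Definition hausdorff2_gauge (delta : R) A : \bar R :=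
  if ediam A <= delta%:E then (pi / 4)%:E * ediam A * ediam A else +oo.

Definition hausdorff2 A : \bar R :=
  ereal_sup [set mu_ext (hausdorff2_gauge delta) A
            | delta in [set delta : R | (0 < delta)%R]].

Let g0 delta : (0 < delta)%R -> hausdorff2_gauge delta set0 = 0.
Proof. by move=> d0; rewrite /hausdorff2_gauge ediam0 lee_fin ltW// mule0. Qed.

Let g_ge0 delta A : 0 <= hausdorff2_gauge delta A.
Proof.
rewrite /hausdorff2_gauge; case: ifPn => // _.
by rewrite !mule_ge0 ?ediam_ge0// lee_fin divr_ge0// pi_ge0.
Qed.

Let g_anti (d1 d2 : R) A : (d1 <= d2)%R ->
  hausdorff2_gauge d2 A <= hausdorff2_gauge d1 A.
Proof.
move=> d12; rewrite /hausdorff2_gauge.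
case: (boolP (ediam A <= d1%:E)) => h1; last by rewrite leey.
by rewrite (le_trans h1)// lee_fin.
Qed.

Let h_ub delta A : (0 < delta)%R ->
  mu_ext (hausdorff2_gauge delta) A <= hausdorff2 A.
Proof. by move=> d0; apply: ereal_sup_ubound; exists delta. Qed.

Let hausdorff2_set0 : hausdorff2 set0 = 0.
Proof.
apply/eqP; rewrite eq_le; apply/andP; split.
  by apply: ge_ereal_sup => _ [d d0 <-]; rewrite mu_ext0// g0.
by rewrite -(mu_ext0 (g0 (@ltr01 R)) (@g_ge0 _)); exact: h_ub.
Qed.

Let hausdorff2_ge0 A : 0 <= hausdorff2 A.
Proof. by apply: le_trans (h_ub _ (@ltr01 R)); exact: mu_ext_ge0. Qed.

Let le_hausdorff2 : {homo hausdorff2 : A B / A `<=` B >-> A <= B}.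
Proof.
move=> A B AB; apply: ge_ereal_sup => _ [d d0 <-].
exact: le_trans (le_mu_ext _ AB) (h_ub _ d0).
Qed.

Let hausdorff2_sigma_subadditive : sigma_subadditive hausdorff2.
Proof.
move=> F; apply: ge_ereal_sup => _ [d d0 <-].
apply: le_trans (mu_ext_sigma_subadditive (@g_ge0 d) F) _.
by apply: lee_nneseries => [i _ _|i _]; [exact: mu_ext_ge0|exact: h_ub].
Qed.

HB.instance Definition _ := isOuterMeasure.Build R 'rV[R]_n hausdorff2
  hausdorff2_set0 hausdorff2_ge0 le_hausdorff2 hausdorff2_sigma_subadditive.

Let sep A B := exists2 e : R, (0 < e)%R & forall a b, A a -> B b -> (e <= `|a - b|)%R.

Let mu_ext_sep (e d : R) A B : (0 < d)%R -> (d < e)%R ->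
  (forall a b, A a -> B b -> (e <= `|a - b|)%R) ->
  mu_ext (hausdorff2_gauge d) A + mu_ext (hausdorff2_gauge d) B <=
  mu_ext (hausdorff2_gauge d) (A `|` B).
Proof.
move=> d0 de AB; apply: le_ereal_inf_tmp => _ [F [mF ABF] <-].
pose G C k := if pselect (F k `&` C !=set0) then F k else set0.
have GE C : C `<=` A `|` B -> mu_ext (hausdorff2_gauge d) C <=
    \sum_(k <oo) hausdorff2_gauge d (G C k).
  move=> CAB; apply: ereal_inf_lbound; exists (G C) => //; split.
    by move=> i; rewrite /G; case: pselect => [?|?]; [exact: mF|exact: measurable0].
  move=> x Cx; have [k _ Fkx] := ABF _ (CAB _ Cx).
  by exists k => //; rewrite /G; case: pselect => // -[]; exists x.
apply: le_trans (leeD (GE A _) (GE B _)) _; [exact: subsetUl|exact: subsetUr|].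
rewrite -nneseriesD//; apply: lee_nneseries => [i _ _|i _]; first exact: adde_ge0.
rewrite /G; case: pselect => [[a [Fa Aa]]|?]; case: pselect => [[b [Fb Bb]]|?].
- rewrite [leRHS]/hausdorff2_gauge ifF ?leey//; apply/negbTE; rewrite -ltNge.
  rewrite (lt_le_trans _ (norm_le_ediam Fa Fb))// lte_fin.
  by rewrite (lt_le_trans de)//; exact: AB.
- by rewrite (g0 d0) adde0.
- by rewrite (g0 d0) add0e.
- by rewrite (g0 d0) adde0.
Qed.

Let hausdorff2_sep A B : sep A B ->
  hausdorff2 A + hausdorff2 B <= hausdorff2 (A `|` B).
Proof.
move=> [e e0 AB].
have [->|] := eqVneq (hausdorff2 (A `|` B)) +oo; first by rewrite leey.
rewrite -ltey => ABoo.
have hfin C : C `<=` A `|` B -> hausdorff2 C \is a fin_num.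
  move=> CAB; rewrite ge0_fin_numE//.
  exact: le_lt_trans (le_hausdorff2 CAB) ABoo.
apply/lee_addgt0Pr => z z0.
have z20 : (0 < z / 2)%R by rewrite divr_gt0.
have [_ [d1 d10 <-] hA] := ub_ereal_sup_adherent z20 (hfin A (@subsetUl _ _ _)).
have [_ [d2 d20 <-] hB] := ub_ereal_sup_adherent z20 (hfin B (@subsetUr _ _ _)).
pose d : R := (Num.min (e / 2) (Num.min d1 d2))%R.
have d0 : (0 < d)%R by rewrite !lt_min divr_gt0// d10 d20.
have hle C d' : (d <= d')%R -> mu_ext (hausdorff2_gauge d') C <=
    mu_ext (hausdorff2_gauge d) C.
  move=> dd'; apply: le_ereal_inf_tmp => _ [F CF <-].
  apply: (@le_trans _ _ (\sum_(k <oo) hausdorff2_gauge d' (F k))).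
    by apply: ereal_inf_lbound; exists F.
  by apply: lee_nneseries => // i _; exact: g_anti.
have : hausdorff2 A - (z / 2)%:E + (hausdorff2 B - (z / 2)%:E) <=
    hausdorff2 (A `|` B).
  apply: le_trans (h_ub _ d0).
  apply: le_trans (mu_ext_sep d0 _ AB); last first.
    by rewrite gt_min (_ : (e / 2 < e)%R)// ltr_pdivrMr// ltr_pMr// ltr1n.
  apply: leeD.
    by apply: le_trans (ltW hA) _; apply: hle; rewrite /d !ge_min lexx orbT.
  by apply: le_trans (ltW hB) _; apply: hle; rewrite /d !ge_min lexx !orbT.
rewrite addeACA -oppeD// -EFinD -splitr leeBlDr//.
Qed.

Let away C k : set 'rV[R]_n :=
  [set x | forall c, C c -> (k.+1%:R^-1 <= `|x - c|)%R].

Let away_bigcup C : closed C -> ~` C = \bigcup_k away C k.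
Proof.
move=> Cc; apply/seteqP; split=> x /=.
  move=> Cx; have /nbhs_ballP[e /= e0 xeC] : nbhs x (~` C).
    by apply: open_nbhs_nbhs; split=> //; exact: closed_openC.
  have [k ke] : exists k : nat, (k.+1%:R^-1 < e)%R.
    by have /ltr_add_invr[k] := e0; rewrite add0r; exists k.
  exists k => // c Cc'; rewrite leNgt; apply/negP => xc.
  apply: (xeC c) => //; rewrite -ball_normE /ball_ /=.
  exact: lt_trans ke.
case=> k _ kx Cx; have := kx _ Cx; rewrite subrr normr0 leNgt invr_gt0.
by rewrite ltr0n.
Qed.

Let away_sub C j k : (j <= k)%N -> away C j `<=` away C k.
Proof.
move=> jk x jx c Cc; apply: le_trans (jx _ Cc).
by rewrite lef_pV2 ?posrE ?ltr0n// ler_nat.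
Qed.

Let shell C X k := X `&` (away C k.+1 `\` away C k).

Let shell_sep C X k : sep (X `&` away C k) (shell C X k.+1).
Proof.
exists (k.+1%:R^-1 - k.+2%:R^-1)%R.
  by rewrite subr_gt0 ltf_pV2 ?posrE ?ltr0n// ltr_nat.
move=> x y [_ xk] [_ [_]] /existsNP[c /not_implyP[Cc /negP]]; rewrite -ltNge => yc.
rewrite lerBlDr (le_trans (xk _ Cc))//.
by rewrite (le_trans (ler_distD y _ _))// lerD2l ltW.
Qed.

Let shell_sum C X a N :
  \sum_(0 <= j < N) hausdorff2 (shell C X (j.*2 + a)) <=
  hausdorff2 (X `&` away C ((N.*2 + a).-1)).
Proof.
elim: N => [|N ih]; first by rewrite big_geq.
rewrite big_nat_recr// doubleS !addSn /=.
case: N ih => [|N] ih.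
  rewrite big_geq// add0e; apply: le_hausdorff2 => x [Xx [+ _]]; split=> //.
apply: le_trans (leeD2r _ ih) _.
have -> : (N.+1.*2 + a)%N = (N.*2.+1 + a).+1%N by rewrite doubleS !addSn.
apply: le_trans (hausdorff2_sep (shell_sep C X (N.*2.+1 + a))) _.
apply: le_hausdorff2 => x [[Xx ax]|[Xx [ax _]]]; split=> //.
by apply: away_sub ax; do 2 apply: leqW.
Qed.

Lemma closed_caratheodory_hausdorff2 C : closed C -> hausdorff2.-caratheodory C.
Proof.
move=> Cc; apply: le_caratheodory_measurable => X.
have [Xoo|] := eqVneq (hausdorff2 X) +oo; first by rewrite [leRHS]Xoo leey.
rewrite -ltey => Xoo.
pose r k := hausdorff2 (shell C X k).
have r_ge0 k : 0 <= r k by exact: hausdorff2_ge0.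
have half_sum a : \sum_(j <oo) r (j.*2 + a)%N <= hausdorff2 X.
  apply: lime_le; first exact: is_cvg_nneseries.
  near=> N; apply: le_trans (shell_sum C X a N) _.
  by apply: le_hausdorff2; exact: subIsetl.
have rE N : \sum_(0 <= k < N.*2) r k =
    \sum_(0 <= j < N) r (j.*2 + 0)%N + \sum_(0 <= j < N) r (j.*2 + 1)%N.
  elim: N => [|N ih]; first by rewrite !big_geq// adde0.
  rewrite doubleS !big_nat_recr//= ih addn0 addn1 -!addeA; congr (_ + _).
  by rewrite addeCA.
have r_sum : \sum_(k <oo) r k < +oo.
  apply: (@le_lt_trans _ _ (hausdorff2 X + hausdorff2 X)); last first.
    by rewrite lte_add_pinfty.
  apply: lime_le; first exact: is_cvg_nneseries.
  near=> N; apply: (@le_trans _ _ (\sum_(0 <= k < N.*2) r k)).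
    by apply: lee_sum_nneg_natr => //; rewrite -addnn leq_addr.
  rewrite rE; apply: leeD; apply: le_trans (half_sum _);
    exact: nneseries_lim_ge.
have tail0 := nneseries_tail_cvg r_sum (fun k _ => r_ge0 k).
have hfin Y : Y `<=` X -> hausdorff2 Y \is a fin_num.
  move=> YX; rewrite ge0_fin_numE//; exact: le_lt_trans (le_hausdorff2 YX) Xoo.
have bound N : hausdorff2 (X `&` C) + hausdorff2 (X `&` ~` C) <=
    hausdorff2 X + \sum_(N <= k <oo) r k.
  have XN : hausdorff2 (X `&` ~` C) <=
      hausdorff2 (X `&` away C N) + \sum_(N <= k <oo) r k.
    apply: (@le_trans _ _ (hausdorff2 ((X `&` away C N) `|`
        \bigcup_k shell C X (k + N)))).
      apply: le_hausdorff2 => x [Xx]; rewrite away_bigcup// => -[k _ kx].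
      have [kN|Nk] := leqP k N; first by left; split=> //; exact: away_sub kx.
      elim: k kx Nk => // k ih kx Nk.
      have [kx'|kx'] := pselect (away C k x).
        have [Nk'|kN'] := ltnP N k; first exact: ih.
        by left; split => //; exact: away_sub kx'.
      by right; exists (k - N)%N => //; rewrite subnK.
    apply: le_trans (outer_measureU2 _ _ _) _; apply: leeD2l.
    apply: le_trans (outer_measure_sigma_subadditive _ _) _.
    by rewrite -(@nneseries_addn _ r).
  apply: le_trans (leeD2l _ XN) _; rewrite addeA; apply: leeD2r.
  apply: le_trans (hausdorff2_sep _) _.
    exists N.+1%:R^-1%R; first by rewrite invr_gt0.
    by move=> c x [_ Cc'] [_ ax]; rewrite distrC; exact: ax.
  by apply: le_hausdorff2 => x [[]|[]].
apply/lee_addgt0Pr => e e0.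
have /= [N _] : \forall N \near \oo, \sum_(N <= k <oo) r k < e%:E.
  have : nbhs (0 : \bar R) [set x | x < e%:E].
    by apply: open_nbhs_nbhs; split; [exact: open_ereal_lt_ereal|rewrite /= lte_fin].
  by move/tail0.
move=> /(_ N (leqnn N)) /= re.
by apply: le_trans (bound N) _; apply: leeD2l; exact: ltW.
Unshelve. all: by end_near. Qed.

Lemma measurable_caratheodory_hausdorff2 A :
  measurable A -> hausdorff2.-caratheodory A.
Proof.
apply: smallest_sub; last first.
  move=> B Bo; rewrite -(setCK B); apply: caratheodory_measurable_setC.
  by apply: closed_caratheodory_hausdorff2; exact: open_closedC.
split.
- exact: caratheodory_measurable_set0.
- by move=> B mB; rewrite setTD; exact: caratheodory_measurable_setC.
- exact: caratheodory_measurable_bigcup.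
Qed.

Let hausdorff2_sigma_additive :
  semi_sigma_additive (hausdorff2 : set 'rV[R]_n -> \bar R).
Proof.
move=> F mF tF mUF.
apply: (@caratheodory_measure_sigma_additive _ _ hausdorff2 F) => //.
  by move=> i; exact: measurable_caratheodory_hausdorff2.
exact: measurable_caratheodory_hausdorff2.
Qed.

HB.instance Definition _ := isMeasure.Build _ 'rV[R]_n R hausdorff2
  hausdorff2_set0 hausdorff2_ge0 hausdorff2_sigma_additive.

End hausdorff2.

Section lebesgue3.
Context {R : realType}.

Definition row3 (p : measurableTypeR R * measurableTypeR R * measurableTypeR R) :
  'rV[R]_3 := \row_(i < 3) [:: p.1.1; p.1.2; p.2]`_i.

Definition lebesgue3 : set 'rV[R]_3 -> \bar R :=
  pushforward (lebesgue_measure \x lebesgue_measure \x lebesgue_measure)%E row3.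

Let measurable_row3 : measurable_fun setT row3.
Proof.
apply: measurable_fun_mx => i j; rewrite /row3.
under eq_fun do rewrite mxE.
case: j => -[|[|[|//]]] ? /=.
- exact: (measurableT_comp measurable_fst measurable_fst).
- exact: (measurableT_comp measurable_snd measurable_fst).
- exact: measurable_snd.
Qed.

Let lebesgue3_set0 : lebesgue3 set0 = 0%E.
Proof. by rewrite /lebesgue3 /pushforward preimage_set0 measure0. Qed.

Let lebesgue3_ge0 A : (0 <= lebesgue3 A)%E.
Proof. exact: measure_ge0. Qed.

Let lebesgue3_sigma_additive : semi_sigma_additive lebesgue3.
Proof.
move=> F mF tF mUF; rewrite /lebesgue3 /pushforward preimage_bigcup.
apply: measure_semi_sigma_additive.
- by move=> k; rewrite -[X in measurable X]setTI; exact: measurable_row3.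
- apply/trivIsetP => /= i j _ _ ij; rewrite -preimage_setI.
  by move/trivIsetP : tF => /(_ _ _ _ _ ij) ->//; rewrite preimage_set0.
- by rewrite -preimage_bigcup -[X in measurable X]setTI; exact: measurable_row3.
Qed.

HB.instance Definition _ := isMeasure.Build _ 'rV[R]_3 R lebesgue3
  lebesgue3_set0 lebesgue3_ge0 lebesgue3_sigma_additive.

End lebesgue3.

Section lipschitz_domain.
Context {R : realType}.
Implicit Types (Omega : set 'rV[R]_3).

Definition boundary Omega : set 'rV[R]_3 := closure Omega `\` interior Omega.

(* Near each boundary point, in the orthonormal frame given by the rows of Q,
   Omega is the open region above the graph of a Lipschitz function psi of the
   first two coordinates [lsubmx y] of y : 'rV_(2 + 1). *)
Definition lipschitz_boundary Omega : Prop :=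
  forall p, boundary Omega p ->
  exists (Q : 'M[R]_3) (r h : R) (psi : 'rV[R]_2 -> R),
    [/\ Q *m Q^T = 1%:M, 0 < r, 0 < h, lipschitz psi &
     forall y : 'rV[R]_(2 + 1), `|lsubmx y| < r -> `|y 0 ord_max| < h ->
       Omega (p + y *m Q) <-> psi (lsubmx y) < y 0 ord_max].

Definition bounded_lipschitz_domain Omega : Prop :=
  [/\ open Omega, connected Omega, Omega !=set0, bounded_set Omega &
      lipschitz_boundary Omega].

End lipschitz_domain.

Section sobolev.
Context {R : realType}.
Implicit Types (Omega : set 'rV[R]_3).

Fixpoint Ck (k : nat) (phi : 'rV[R]_3 -> R) : Prop :=
  if k is k'.+1 then
    (forall x, differentiable phi x) /\
    forall i : 'I_3, Ck k' (fun x => 'D_(delta_mx 0 i) phi x)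
  else continuous phi.

Definition test_function Omega (phi : 'rV[R]_3 -> R) : Prop :=
  (forall k, Ck k phi) /\
  exists K, [/\ compact K, K `<=` Omega & forall x, ~ K x -> phi x = 0].

Definition L2 Omega (v : 'rV[R]_3 -> R) : Prop :=
  measurable_fun Omega v /\
  (\int[lebesgue3]_(x in Omega) ((v x) ^+ 2)%:E < +oo)%E.

Definition weak_partial Omega (j : 'I_3) (v w : 'rV[R]_3 -> R) : Prop :=
  forall phi, test_function Omega phi ->
    \int[lebesgue3]_(x in Omega) (v x * 'D_(delta_mx 0 j) phi x) =
    - \int[lebesgue3]_(x in Omega) (w x * phi x).

(* u is in H^1(Omega; R^3) with weak gradient (Du)_ij = d u_i / d x_j *)
Definition sobolev_H1 Omega (u : 'rV[R]_3 -> 'rV[R]_3)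
    (Du : 'rV[R]_3 -> 'M[R]_3) : Prop :=
  [/\ forall i, L2 Omega (fun x => u x 0 i),
      forall i j, L2 Omega (fun x => Du x i j) &
      forall i j, weak_partial Omega j (fun x => u x 0 i) (fun x => Du x i j)].

(* Trace in the sense of measurable functions: tau is measurable on the
   boundary and, at almost every boundary point x, is the limit of v in the
   mean over Omega inside shrinking balls around x. On H^1(Omega) this is the
   usual trace, but it makes sense for any measurable v, such as the weak
   gradient of an H^1 function. *)
Definition is_trace Omega (v tau : 'rV[R]_3 -> R) : Prop :=
  measurable_fun (boundary Omega) tau /\
  {ae hausdorff2, forall x, boundary Omega x ->
    ((\int[lebesgue3]_(y in Omega `&` eball x r) `|v y - tau x|%:E) /
       lebesgue3 (Omega `&` eball x r))%E @[r --> 0^'+] --> 0%E}.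

Definition is_trace_mx m n Omega (v tau : 'rV[R]_3 -> 'M[R]_(m, n)) : Prop :=
  forall i j, is_trace Omega (fun x => v x i j) (fun x => tau x i j).

End sobolev.

Record material (R : realType) := Material {
  lame_lambda : R;
  lame_mu : R;
  RO_K : R;
  RO_n' : R;
  CMB_sigma_f' : R;
  CMB_eps_f' : R;
  CMB_b : R;
  CMB_c : R;
  lame_lambda_gt0 : 0 < lame_lambda;
  lame_mu_gt0 : 0 < lame_mu;
  RO_K_gt0 : 0 < RO_K;
  RO_n'_gt0 : 0 < RO_n';
  CMB_sigma_f'_gt0 : 0 < CMB_sigma_f';
  CMB_eps_f'_gt0 : 0 < CMB_eps_f';
  CMB_b_lt0 : CMB_b < 0;
  CMB_c_lt0 : CMB_c < 0
}.

Section elasticity.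
Context {R : realType} (mat : material R).
Local Notation lambda := (lame_lambda mat).
Local Notation mu := (lame_mu mat).

(* sigma(u), as a function of M = grad u *)
Definition stress (M : 'M[R]_3) : 'M[R]_3 :=
  (lambda * \tr M)%:M + mu *: (M + M^T).

Definition dotv (a b : 'rV[R]_3) : R := \sum_(i < 3) a 0 i * b 0 i.

Definition zero_on (D : set 'rV[R]_3) (tau : 'rV[R]_3 -> 'rV[R]_3) : Prop :=
  {ae hausdorff2, forall x, D x -> tau x = 0}.

(* Weak form of div sigma(u) + f = 0 in Omega, u = 0 on GammaD and
   sigma(u) nu = g on GammaN: for all v in H^1 vanishing on GammaD,
   int_Omega sigma(u) : grad v dx = int_Omega f.v dx + int_GammaN g.v dA. *)
Definition weak_solution (Omega GammaD GammaN : set 'rV[R]_3)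
    (f g : 'rV[R]_3 -> 'rV[R]_3)
    (u : 'rV[R]_3 -> 'rV[R]_3) (Du : 'rV[R]_3 -> 'M[R]_3) : Prop :=
  [/\ sobolev_H1 Omega u Du,
      exists2 tu, is_trace_mx Omega u tu & zero_on GammaD tu &
      forall v Dv tv, sobolev_H1 Omega v Dv -> is_trace_mx Omega v tv ->
        zero_on GammaD tv ->
      [/\ lebesgue3.-integrable Omega (fun x => (dotv (f x) (v x))%:E),
          hausdorff2.-integrable GammaN (fun x => (dotv (g x) (tv x))%:E) &
          \int[lebesgue3]_(x in Omega) \tr (stress (Du x) *m (Dv x)^T) =
          \int[lebesgue3]_(x in Omega) dotv (f x) (v x) +
          \int[hausdorff2]_(x in GammaN) dotv (g x) (tv x)]].

Definition unique_weak_solution (Omega GammaD GammaN : set 'rV[R]_3)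
    (f g : 'rV[R]_3 -> 'rV[R]_3) : Prop :=
  exists u Du, weak_solution Omega GammaD GammaN f g u Du /\
    forall u' Du', weak_solution Omega GammaD GammaN f g u' Du' ->
      {ae lebesgue3, forall x, Omega x -> u' x = u x}.

End elasticity.

Section fatigue_life.
Context {R : realType} (mat : material R).
Local Notation lambda := (lame_lambda mat).
Local Notation mu := (lame_mu mat).
Local Notation K := (RO_K mat).
Local Notation n' := (RO_n' mat).

Definition young : R := mu * (3 * lambda + 2 * mu) / (lambda + mu).

Definition RO (s : R) : R := s / young + (s / K) `^ n'^-1.

Definition SD (sv : R) : R :=
  get [set s : R | 0 < s /\
    sv ^+ 2 / young = s ^+ 2 / young + s * (s / K) `^ n'^-1].

Definition CMB (N : R) : R :=
  CMB_sigma_f' mat / young * (2 * N) `^ CMB_b mat +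
  CMB_eps_f' mat * (2 * N) `^ CMB_c mat.

Definition CMB_inv (e : R) : R := get [set N : R | 0 < N /\ CMB N = e].

Definition life (sv : R) : \bar R :=
  if sv == 0 then +oo%E else (CMB_inv (RO (SD sv)))%:E.

Definition deviator (S : 'M[R]_3) : 'M[R]_3 := S - (\tr S / 3)%:M.

Definition von_mises (S : 'M[R]_3) : R :=
  Num.sqrt (3 / 2 * \tr (deviator S *m deviator S)).

Definition Ndet (M : 'M[R]_3) : \bar R := life (von_mises (stress mat M)).

(* In \bar R the inverse satisfies +oo^-1 = 0. *)
Definition inv_Ndet (M : 'M[R]_3) : R := fine ((Ndet M)^-1)%E.

(* || 1 / N_det(grad u) ||_{L^m(boundary Omega)}, where tDu is the trace of
   grad u *)
Definition inv_Ndet_norm (m : R) (Omega : set 'rV[R]_3)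
    (tDu : 'rV[R]_3 -> 'M[R]_3) : \bar R :=
  'N[hausdorff2]_m%:E [(fun x => (Ndet (tDu x))^-1) \_ (boundary Omega)]%E.

End fatigue_life.

Section crack_initiation.
Context {R : realType}.
Local Notation R3 := 'rV[R]_3.

Definition spacetime := (measurableTypeR R * R3)%type.

Definition time_axis : set R := `[0, +oo[.

Definition crack_space (Omega_ext : set R3) : set spacetime :=
  time_axis `*` Omega_ext.

Definition crack_space_upto (Omega_ext : set R3) (t : R) : set spacetime :=
  crack_space Omega_ext `&` [set p | p.1 <= t].

Definition bounded_spacetime (B : set spacetime) : Prop :=
  bounded_set (B : set (R * R3)).

(* arguments: t, x, u(x), grad u(x) *)
Definition intensity := R -> R3 -> R3 -> 'M[R]_3 -> R.

Definition admissible_intensity (rho : intensity) : Prop :=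
  (forall t x v M, time_axis t -> 0 <= rho t x v M) /\
  measurable_fun
    [set p : measurableTypeR R * R3 * R3 * 'M[R]_3 | time_axis p.1.1.1]
    (fun p => rho p.1.1.1 p.1.1.2 p.1.2 p.2).

Definition zero_regular (rho : intensity) : Prop :=
  forall t x v, time_axis t -> continuous (rho t x v).

(* tu, tDu are the traces of u, Du, used in the boundary term *)
Definition intensity_measure (rho_vol rho_sur : intensity) (Omega : set R3)
    (u tu : R3 -> R3) (Du tDu : R3 -> 'M[R]_3) (B : set spacetime) : \bar R :=
  (\int[lebesgue_measure \x^ lebesgue3]_(p in B `&` (time_axis `*` Omega))
     (rho_vol p.1 p.2 (u p.2) (Du p.2))%:E +
   \int[lebesgue_measure \x^ hausdorff2]_(p in
        B `&` (time_axis `*` boundary Omega))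
     (rho_sur p.1 p.2 (tu p.2) (tDu p.2))%:E)%E.

Definition radon_on (C : set spacetime) (rho : set spacetime -> \bar R) : Prop :=
  exists nu : {measure set spacetime -> \bar R},
    (forall B, measurable B -> B `<=` C -> rho B = nu B) /\
    (forall B, measurable B -> B `<=` C -> bounded_spacetime B ->
       (nu B < +oo)%E).

Definition local_crack_model1 (Omega_ext : set R3) (rho_vol rho_sur : intensity)
    (Omega : set R3) (u tu : R3 -> R3) (Du tDu : R3 -> 'M[R]_3) : Prop :=
  [/\ admissible_intensity rho_vol, admissible_intensity rho_sur &
      radon_on (crack_space Omega_ext)
        (intensity_measure rho_vol rho_sur Omega u tu Du tDu)].

Definition lcf_vol : intensity := fun _ _ _ _ => 0.

Definition lcf_sur (mat : material R) (m : R) : intensity := fun t _ _ M =>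
  m * inv_Ndet mat M * (t * inv_Ndet mat M) `^ (m - 1).

End crack_initiation.

Section poisson_point_process.
Context {R : realType} d (S : measurableType d) (P : probability S R).
Local Notation R3 := 'rV[R]_3.

(* random locally finite counting measure on C *)
Definition point_process (C : set (@spacetime R))
    (gamma : S -> {measure set (@spacetime R) -> \bar R}) : Prop :=
  [/\ forall B, measurable B -> measurable_fun setT (fun w => gamma w B),
      forall w, gamma w (~` C) = 0%E &
      forall w B, measurable B -> B `<=` C -> bounded_spacetime B ->
        exists k : nat, gamma w B = k%:R%:E].

Definition independent_counts n (gamma : S -> {measure set (@spacetime R) -> \bar R})
    (B : 'I_n -> set (@spacetime R)) : Prop :=
  forall A : 'I_n -> set (\bar R), (forall i, measurable (A i)) ->
    P (\bigcap_i [set w | A i (gamma w (B i))]) =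
    (\prod_(i < n) P [set w | A i (gamma w (B i))])%E.

(* the second argument of [poisson_prob] is a dummy *)
Definition poisson_point_process (C : set (@spacetime R))
    (rho : set (@spacetime R) -> \bar R)
    (gamma : S -> {measure set (@spacetime R) -> \bar R}) : Prop :=
  [/\ point_process C gamma,
      forall B, measurable B -> B `<=` C -> bounded_spacetime B ->
        forall k : nat, P [set w | gamma w B = k%:R%:E] =
          poisson_prob (fine (rho B)) 0 [set k] &
      forall n (B : 'I_n -> set (@spacetime R)),
        (forall i, [/\ measurable (B i), B i `<=` C & bounded_spacetime (B i)]) ->
        trivIset setT B -> independent_counts gamma B].

Definition crack_initiation_time (Omega_ext : set R3)
    (gamma : S -> {measure set (@spacetime R) -> \bar R}) (w : S) : \bar R :=
  ereal_inf [set t%:E | t in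
    [set t : R | 0 < t /\ (0 < gamma w (crack_space_upto Omega_ext t))%E]].

(* scale eta in (0, +oo] *)
Definition weibull_cdf (m : R) (eta : \bar R) (t : R) : R :=
  if 0 < t then
    if eta is r%:E then 1 - expR (- (t / r) `^ m) else 0
  else 0.

Definition weibull_distributed (m : R) (eta : \bar R) (T : S -> \bar R) : Prop :=
  measurable_fun setT T /\
  forall t : R, P [set w | (T w <= t%:E)%E] = (weibull_cdf m eta t)%:E.

End poisson_point_process.

(* Main.v *)
Require Import Defs.
From HB Require Import structures.
From mathcomp Require Import all_boot all_order all_algebra.
From mathcomp Require Import all_classical all_reals all_analysis.
From mathcomp Require Import measurable_realfun.
Set Implicit Arguments.
Unset Strict Implicit.
Unset Printing Implicit Defensive.
Import Order.TTheory GRing.Theory Num.Theory.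
Import numFieldNormedType.Exports.
Local Open Scope classical_set_scope.
Local Open Scope ring_scope.

(** All three parts follow from the product form of the surface intensity: for
    [t >= 0] it is [m t^(m-1) h^m], where [h = 1 / N_det(grad u)] ([lcf_surE]).

    Part (ii) asks that [h] depend continuously on the gradient. The von Mises
    stress does ([continuous_von_mises]); what remains is a chain of inverse
    functions, namely [SD] and the inverse of [CMB]. Each of them inverts an
    increasing function [F] on the nonnegative reals, and a function [g] is
    continuous as soon as [F \o g] is ([continuous_increasing_nneg]). To include
    zero stress, where the life is infinite, [CMB] is written in terms of the
    damage per cycle [1 / N] instead of [N]: it becomes increasing and vanishes
    at 0 ([damage_strain]), so that the inverse life tends to 0 with the stress.

    For part (i), Tonelli's theorem shows that the mass of [[0, t] * C], where
    [C] contains the boundary of the domain, is the product of the integral of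
    [m s^(m-1)] over [[0, t]] and of the integral of [h^m] over the boundary,
    that is [t^m N^m] with [N] the L^m norm of [h] ([intensity_measure_slab]).
    Bounded sets lie in such a set, hence have finite mass.

    For part (iii), the crack initiation time is at most [t >= 0] if and only if
    the slab up to time [t] contains a point ([initiation_time_leP]). The number
    of points in the slab is a Poisson variable with mean [(t N)^m], so this has
    probability [1 - exp (- (t N)^m)], the value at [t] of the Weibull
    distribution function with shape [m] and scale [1 / N]. *)

(** * Continuity of inverses of increasing functions *)

Section increasing.
Context {R : realType}.
Implicit Types F : R -> R.

Definition increasing_nneg F := forall x y : R, 0 <= x -> x < y -> F x < F y.

Lemma increasing_nneg_le F (x y : R) : increasing_nneg F ->
  0 <= x -> x <= y -> F x <= F y.
Proof.
by move=> iF x0; rewrite le_eqVlt => /predU1P[->//|xy]; exact/ltW/iF.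
Qed.

(** A jump of [g] would force a jump of [F \o g]. If [g] is defined by inverting
    [F], then [F \o g] is explicit, and the continuity of [g] is read off
    from it. *)
Lemma continuous_increasing_nneg (T : topologicalType) F (g : T -> R) :
  increasing_nneg F -> (forall z, 0 <= g z) ->
  continuous (fun z => F (g z)) -> continuous g.
Proof.
move=> iF g0 cFg z; apply/cvgrPdist_lt => e e0.
have upper : \forall w \near z, g w < g z + e.
  have : F (g z) < F (g z + e) by apply: iF; rewrite ?ltrDl.
  move/(cvgr_lt _ (cFg z)); apply: filterS => w; apply: contraTT.
  rewrite -!leNgt; apply: increasing_nneg_le => //.
  by rewrite addr_ge0// ltW.
have lower : \forall w \near z, g z - e < g w.
  have [ge|ge] := ltP (g z - e) 0.
    by apply: nearW => w; exact: lt_le_trans (g0 w).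
  have : F (g z - e) < F (g z) by apply: iF; rewrite // ltrBlDr ltrDl.
  move/(cvgr_gt _ (cFg z)); apply: filterS => w; apply: contraTT.
  by rewrite -!leNgt; exact: increasing_nneg_le.
near=> w; rewrite ltr_distlC; apply/andP.
by split; near: w; [exact: lower|exact: upper].
Unshelve. all: by end_near. Qed.

(** [F] is composed with the truncation at 0 because the functions to be
    inverted contain powers, which are discontinuous at 0 from the left
    ([x `^ p = 1] for negative [x]). *)
Lemma increasing_nneg_surj F (y : R) :
  continuous (fun x : R => F (Num.max x 0)) -> F 0 = 0 ->
  (exists2 x, 0 <= x & y <= F x) -> 0 <= y -> exists2 x, 0 <= x & F x = y.
Proof.
move=> cF F0 [b b0 yFb] y0.
have [|c] := @IVT _ (fun x => F (Num.max x 0)) 0 b y b0 (continuous_subspaceT cF).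
  by rewrite maxxx F0 (max_idPl b0) ge_min y0/= le_max yFb orbT.
rewrite in_itv/= => /andP[c0 _]; rewrite (max_idPl c0) => Fc.
by exists c.
Qed.

Lemma continuous_powR_nneg (T : topologicalType) (p : R) (k : T -> R) :
  0 < p -> (forall z, 0 <= k z) -> continuous k ->
  continuous (fun z => k z `^ p).
Proof.
move=> p0 k0 ck.
(* The p-th power is the inverse of the increasing p^-1-th power. *)
apply: (@continuous_increasing_nneg _ (fun x => x `^ p^-1)) => [x y x0 xy|z|].
- by rewrite gt0_ltr_powR ?invr_gt0// nnegrE// (le_trans x0)// ltW.
- exact: powR_ge0.
- under eq_fun do rewrite -powRrM divff ?gt_eqF// powRr1//.
  exact: ck.
Qed.

Lemma continuous_mull (T : topologicalType) (a : R) (k : T -> R) :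
  continuous k -> continuous (fun z => a * k z).
Proof. by move=> ck z; apply: cvgMl_tmp; exact: ck. Qed.

Lemma continuous_sqr (T : topologicalType) (k : T -> R) :
  continuous k -> continuous (fun z => k z ^+ 2).
Proof.
move=> ck z; apply: (@continuous_comp _ _ _ k (fun x => x ^+ 2)); first exact: ck.
exact: exprn_continuous.
Qed.

Lemma continuous_max0 : continuous (fun x : R => Num.max x 0).
Proof.
move=> x; apply: (@continuous_max R R id (cst 0) x); first exact: cvg_id.
exact: cvg_cst.
Qed.

End increasing.

(** * Continuity of the inverse life *)

Section fatigue_life_continuity.
Context {R : realType} (mat : material R).
Local Notation E := (young mat).
Local Notation p := (RO_n' mat)^-1.
Local Notation K := (RO_K mat).

Lemma young_gt0 : 0 < E.
Proof.
have [l0 m0] := (lame_lambda_gt0 mat, lame_mu_gt0 mat).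
by rewrite /young divr_gt0 ?mulr_gt0 ?addr_gt0 ?mulr_gt0.
Qed.

Let p_gt0 : 0 < p. Proof. by rewrite invr_gt0 RO_n'_gt0. Qed.

Let K_gt0 : 0 < K. Proof. exact: RO_K_gt0. Qed.

Lemma increasing_ramberg_osgood_term : increasing_nneg (fun s => (s / K) `^ p).
Proof.
move=> x y x0 xy; have y0 : 0 <= y by rewrite (le_trans x0)// ltW.
by rewrite gt0_ltr_powR ?nnegrE ?divr_ge0 ?(ltW K_gt0)// ltr_pM2r ?invr_gt0.
Qed.

Lemma RO0 : RO mat 0 = 0.
Proof. by rewrite /RO !mul0r powR0 ?add0r// gt_eqF. Qed.

Lemma RO_gt0 s : 0 < s -> 0 < RO mat s.
Proof.
move=> s0; apply: addr_gt0; first by rewrite divr_gt0 ?young_gt0.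
by apply: powR_gt0; rewrite divr_gt0.
Qed.

Lemma continuous_RO (T : topologicalType) (k : T -> R) :
  (forall z, 0 <= k z) -> continuous k -> continuous (fun z => RO mat (k z)).
Proof.
move=> k0 ck z; apply: cvgD; first by apply: cvgMr_tmp; exact: ck.
apply: (@continuous_powR_nneg _ _ _ (fun z => k z / K)) => // w.
  by rewrite divr_ge0 ?(ltW K_gt0).
by apply: cvgMr_tmp; exact: ck.
Qed.

(** Right-hand side of Neuber's rule, the equation that defines [SD]. *)
Definition neuber s : R := s ^+ 2 / E + s * (s / K) `^ p.

Lemma increasing_neuber : increasing_nneg neuber.
Proof.
move=> x y x0 xy; have y0 : 0 < y by exact: le_lt_trans xy.
apply: ltr_leD.
  by rewrite ltr_pM2r ?invr_gt0 ?young_gt0// ltr_pXn2r// nnegrE ltW.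
apply: ler_pM => //; rewrite ?powR_ge0 ?(ltW xy)//.
by apply/ltW/increasing_ramberg_osgood_term.
Qed.

Lemma neuber0 : neuber 0 = 0.
Proof. by rewrite /neuber expr0n/= !mul0r addr0. Qed.

Lemma neuber_surj y : 0 <= y -> exists2 s, 0 <= s & neuber s = y.
Proof.
move=> y0; apply: increasing_nneg_surj => //.
- move=> x; apply: cvgD.
    by apply: cvgMr_tmp; exact: (continuous_sqr continuous_max0).
  apply: cvgM; first exact: continuous_max0.
  apply: (@continuous_powR_nneg _ _ _ (fun z : R => Num.max z 0 / K)) => // w.
    by rewrite divr_ge0 ?(ltW K_gt0)// le_max lexx orbT.
  by apply: cvgMr_tmp; exact: continuous_max0.
- exact: neuber0.
(* At sqrt (y E) the quadratic term alone equals y. *)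
- have z0 : 0 <= Num.sqrt (y * E) by exact: sqrtr_ge0.
  exists (Num.sqrt (y * E)) => //.
  rewrite /neuber sqr_sqrtr; last by apply: mulr_ge0 => //; exact/ltW/young_gt0.
  by rewrite mulfK ?gt_eqF ?young_gt0// lerDl mulr_ge0 ?powR_ge0.
Qed.

Lemma SD_spec v : 0 < v -> 0 < SD mat v /\ v ^+ 2 / E = neuber (SD mat v).
Proof.
move=> v0; rewrite /SD.
suff : [set s : R | 0 < s /\ v ^+ 2 / E = neuber s] !=set0 by move/getPex.
have y0 : 0 < v ^+ 2 / E by rewrite divr_gt0 ?young_gt0 ?exprn_gt0.
have [s s0 Fs] := neuber_surj (ltW y0).
exists s; split=> //; rewrite lt_neqAle s0 andbT; apply/eqP => s0'.
by move: Fs y0; rewrite -s0' neuber0 => <-; rewrite ltxx.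
Qed.

(** [SD 0] is an unspecified real, since the equation has no positive solution
    there; the value 0 is the continuous extension. *)
Definition SD_ext v : R := if v == 0 then 0 else SD mat v.

Lemma SD_ext_ge0 v : 0 <= v -> 0 <= SD_ext v.
Proof.
rewrite /SD_ext; case: eqVneq => // v0 v_ge0.
by apply: ltW; apply: (SD_spec _).1; rewrite lt_neqAle eq_sym v0.
Qed.

Lemma neuber_SD_ext v : 0 <= v -> neuber (SD_ext v) = v ^+ 2 / E.
Proof.
rewrite /SD_ext; case: eqVneq => [->|v0 v_ge0].
  by rewrite neuber0 expr0n/= mul0r.
by rewrite -(SD_spec _).2// lt_neqAle eq_sym v0.
Qed.

Lemma continuous_SD_ext (T : topologicalType) (k : T -> R) :
  (forall z, 0 <= k z) -> continuous k -> continuous (fun z => SD_ext (k z)).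
Proof.
move=> k0 ck; apply: (continuous_increasing_nneg increasing_neuber).
  by move=> z; exact: SD_ext_ge0.
under eq_fun do rewrite neuber_SD_ext//.
by move=> z; apply: cvgMr_tmp; exact: (continuous_sqr ck).
Qed.

(** [CMB] in terms of the damage per cycle [x = 1 / N], which turns a decreasing
    function with a pole at 0 into an increasing one that vanishes at 0. *)
Definition damage_strain x : R :=
  CMB_sigma_f' mat / E * (x / 2) `^ (- CMB_b mat) +
  CMB_eps_f' mat * (x / 2) `^ (- CMB_c mat).

Let b_gt0 : 0 < - CMB_b mat. Proof. by rewrite oppr_gt0 CMB_b_lt0. Qed.
Let c_gt0 : 0 < - CMB_c mat. Proof. by rewrite oppr_gt0 CMB_c_lt0. Qed.
Let sE_gt0 : 0 < CMB_sigma_f' mat / E.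
Proof. by rewrite divr_gt0 ?young_gt0 ?CMB_sigma_f'_gt0. Qed.
Let eps_gt0 : 0 < CMB_eps_f' mat. Proof. exact: CMB_eps_f'_gt0. Qed.

Lemma CMB_invr N : 0 < N -> CMB mat N^-1 = damage_strain N.
Proof.
move=> N0; have h q : (2 / N) `^ q = (N / 2) `^ (- q).
  rewrite powRN -powR_inv1 ?powR_ge0// powRAC powR_inv1 ?invf_div//.
  by rewrite divr_ge0 ?ltW.
by rewrite /CMB /damage_strain !h.
Qed.

Lemma damage_strain0 : damage_strain 0 = 0.
Proof. by rewrite /damage_strain mul0r !powR0 ?gt_eqF// !mulr0 addr0. Qed.

Lemma increasing_damage_strain : increasing_nneg damage_strain.
Proof.
move=> x y x0 xy; have y0 : 0 < y by exact: le_lt_trans xy.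
by apply: ltrD; rewrite ltr_pM2l// gt0_ltr_powR ?nnegrE ?divr_ge0 ?(ltW y0)//
  ltr_pM2r ?invr_gt0.
Qed.

Lemma damage_strain_surj y : 0 <= y -> exists2 x, 0 <= x & damage_strain x = y.
Proof.
move=> y0; apply: increasing_nneg_surj => //; last 2 first.
- exact: damage_strain0.
(* This witness makes the first of the two terms equal to y. *)
- have z0 : 0 <= y / (CMB_sigma_f' mat / E) by rewrite divr_ge0 ?(ltW sE_gt0).
  exists (2 * (y / (CMB_sigma_f' mat / E)) `^ (- CMB_b mat)^-1).
    by rewrite mulr_ge0 ?powR_ge0.
  rewrite /damage_strain [2 * _]mulrC mulfK ?pnatr_eq0//.
  rewrite -powRrM mulVf ?gt_eqF// powRr1// mulrCA divff ?gt_eqF// mulr1.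
  by rewrite lerDl mulr_ge0 ?powR_ge0 ?(ltW eps_gt0).
move=> x; apply: cvgD; apply: cvgMl_tmp;
  apply: (@continuous_powR_nneg _ _ _ (fun z : R => Num.max z 0 / 2)) => // w;
  rewrite ?divr_ge0 ?le_max ?lexx ?orbT//; apply: cvgMr_tmp; exact: continuous_max0.
Qed.

Lemma CMB_inv_spec e : 0 < e -> 0 < CMB_inv mat e /\ CMB mat (CMB_inv mat e) = e.
Proof.
move=> e0; rewrite /CMB_inv.
suff : [set N : R | 0 < N /\ CMB mat N = e] !=set0 by move/getPex.
have [x x0 xe] := damage_strain_surj (ltW e0).
have x_gt0 : 0 < x.
  rewrite lt_neqAle x0 andbT; apply/eqP => x0'.
  by move: xe e0; rewrite -x0' damage_strain0 => <-; rewrite ltxx.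
by exists x^-1; rewrite /= invr_gt0 CMB_invr.
Qed.

Definition inv_life (v : R) : R := fine (life mat v)^-1%E.

(** The last equation also covers [v = 0], where the life is infinite: this is
    what makes the inverse life continuous there. *)
Lemma inv_life_spec v : 0 <= v -> [/\ 0 <= inv_life v,
  (life mat v)^-1%E = (inv_life v)%:E &
  damage_strain (inv_life v) = RO mat (SD_ext v)].
Proof.
rewrite /inv_life /life /SD_ext; case: eqVneq => [_|v_neq0 v0].
  by rewrite invey RO0 damage_strain0.
have S0 : 0 < SD mat v by apply: (SD_spec _).1; rewrite lt_neqAle eq_sym v_neq0.
have [C0 Ce] := CMB_inv_spec (RO_gt0 S0).
by rewrite inver gt_eqF//= invr_ge0 (ltW C0) -CMB_invr ?invr_gt0// invrK.
Qed.

Lemma continuous_inv_life (T : topologicalType) (k : T -> R) :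
  (forall z, 0 <= k z) -> continuous k -> continuous (fun z => inv_life (k z)).
Proof.
move=> k0 ck; apply: (continuous_increasing_nneg increasing_damage_strain).
  by move=> z; have [] := inv_life_spec (k0 z).
rewrite (_ : (fun z => _) = fun z => RO mat (SD_ext (k z))); last first.
  by apply/funext => z; have [_ _ ->] := inv_life_spec (k0 z).
apply: (@continuous_RO _ (fun z => SD_ext (k z))) => [z|].
  exact: SD_ext_ge0.
exact: continuous_SD_ext.
Qed.

End fatigue_life_continuity.

Section Ndet_continuity.
Context {R : realType} (mat : material R).

Lemma continuous_mxtrace (T : topologicalType) n (f : T -> 'M[R]_n) :
  (forall i j, continuous (fun z => f z i j)) -> continuous (fun z => \tr (f z)).
Proof. by move=> cf z; apply: (cvg_big add_continuous) => i _; exact: cf. Qed.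

Lemma continuous_stress (T : topologicalType) (f : T -> 'M[R]_3) :
  (forall i j, continuous (fun z => f z i j)) ->
  forall i j, continuous (fun z => stress mat (f z) i j).
Proof.
move=> cf i j; rewrite (_ : (fun z => _) = fun z =>
    lame_lambda mat * \tr (f z) *+ (i == j) +
    lame_mu mat * (f z i j + f z j i)); last first.
  by apply/funext => z; rewrite !mxE.
move=> z; apply: cvgD; last by apply: cvgMl_tmp; apply: cvgD; exact: cf.
by apply: cvgMn; apply: cvgMl_tmp; exact: continuous_mxtrace.
Qed.

Lemma continuous_deviator (T : topologicalType) (f : T -> 'M[R]_3) :
  (forall i j, continuous (fun z => f z i j)) ->
  forall i j, continuous (fun z => deviator (f z) i j).
Proof.
move=> cf i j; rewrite (_ : (fun z => _) = fun z =>
    f z i j - (\tr (f z) / 3) *+ (i == j)); last first.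
  by apply/funext => z; rewrite !mxE.
move=> z; apply: cvgB; first exact: cf.
by apply: cvgMn; apply: cvgMr_tmp; exact: continuous_mxtrace.
Qed.

Lemma continuous_von_mises (T : topologicalType) (f : T -> 'M[R]_3) :
  (forall i j, continuous (fun z => f z i j)) ->
  continuous (fun z => von_mises (f z)).
Proof.
move=> /continuous_deviator cf z.
apply: (@continuous_comp _ _ _
  (fun z => 3 / 2 * \tr (deviator (f z) *m deviator (f z))) Num.sqrt);
  last exact: sqrt_continuous.
apply: cvgMl_tmp.
apply: (@continuous_mxtrace _ _ (fun z => deviator (f z) *m deviator (f z))).
move=> i j; rewrite (_ : (fun z => _) = fun z =>
    \sum_k deviator (f z) i k * deviator (f z) k j); last first.
  by apply/funext => w; rewrite mxE.
move=> w; apply: (cvg_big add_continuous) => k _.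
by apply: cvgM; exact: cf.
Qed.

Lemma von_mises_ge0 (S : 'M[R]_3) : 0 <= von_mises S.
Proof. exact: sqrtr_ge0. Qed.

Lemma inv_Ndet_ge0 M : 0 <= inv_Ndet mat M.
Proof. by have [] := inv_life_spec mat (von_mises_ge0 (stress mat M)). Qed.

Lemma Ndet_invE M : ((Ndet mat M)^-1)%E = (inv_Ndet mat M)%:E.
Proof. by have [] := inv_life_spec mat (von_mises_ge0 (stress mat M)). Qed.

Lemma continuous_inv_Ndet : continuous (inv_Ndet mat).
Proof.
apply: continuous_inv_life; [by move=> M; exact: sqrtr_ge0|].
apply: continuous_von_mises; apply: continuous_stress => i j.
exact: coord_continuous.
Qed.

End Ndet_continuity.

(** * The Weibull intensity *)

Section weibull_intensity.
Context {R : realType} (mat : material R) (m : R).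
Hypothesis m_gt1 : 1 < m.
Let m1_gt0 : 0 < m - 1. Proof. by rewrite subr_gt0. Qed.
Let m_gt0 : 0 < m. Proof. exact: lt_trans m_gt1. Qed.

(** This fails for [t < 0], where a power of the negative base
    [t * inv_Ndet mat M] does not split into powers of the factors. *)
Lemma lcf_surE t x v M : 0 <= t ->
  lcf_sur mat m t x v M = m * t `^ (m - 1) * inv_Ndet mat M `^ m.
Proof.
move=> t0; rewrite /lcf_sur powRM ?inv_Ndet_ge0// -!mulrA; congr (_ * _).
by rewrite mulrCA mulr_powRB1 ?inv_Ndet_ge0.
Qed.

Lemma zero_regular_lcf_vol : zero_regular (@lcf_vol R).
Proof. by move=> t x v _; exact: cst_continuous. Qed.

Lemma zero_regular_lcf_sur : zero_regular (lcf_sur mat m).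
Proof.
move=> t x v; rewrite /time_axis/= in_itv/= andbT => t0.
rewrite (_ : lcf_sur mat m t x v =
    fun M => m * t `^ (m - 1) * inv_Ndet mat M `^ m); last first.
  by apply/funext => M; exact: lcf_surE.
apply: continuous_mull; apply: continuous_powR_nneg => //.
  exact: inv_Ndet_ge0.
exact: continuous_inv_Ndet.
Qed.

Lemma measurable_inv_Ndet : measurable_fun setT (inv_Ndet mat).
Proof.
apply: (measurability _ (RGenOpens.measurableE R)) => _ [_ [a [b ->]] <-].
rewrite setTI; apply: open_measurable_mx; apply: open_comp => [M _|].
  exact: continuous_inv_Ndet.
exact: itv_open.
Qed.

Lemma admissible_lcf_vol : admissible_intensity (@lcf_vol R).
Proof. by split=> //; exact: measurable_cst. Qed.

Lemma admissible_lcf_sur : admissible_intensity (lcf_sur mat m).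
Proof.
split=> [t x v M|].
  rewrite /time_axis/= in_itv/= andbT => t0.
  by rewrite lcf_surE// !mulr_ge0 ?powR_ge0 ?(ltW m_gt0).
apply: measurable_funTS.
have mN : measurable_fun setT
    (fun p : measurableTypeR R * 'rV[R]_3 * 'rV[R]_3 * 'M[R]_3 => inv_Ndet mat p.2).
  by apply: (measurableT_comp measurable_inv_Ndet); exact: measurable_snd.
apply: measurable_funM; first exact: measurable_funM.
apply: (measurableT_comp (measurable_powR (m - 1))).
apply: measurable_funM => //.
apply: (measurableT_comp measurable_fst).
by apply: (measurableT_comp measurable_fst); exact: measurable_fst.
Qed.

End weibull_intensity.

(** * Integrals over product measures *)

Section tonelli.
Local Open Scope ereal_scope.
Context d1 d2 (T1 : measurableType d1) (T2 : measurableType d2) (R : realType).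
Variables (m1 : {sigma_finite_measure set T1 -> \bar R}).
Variables (m2 : {measure set T2 -> \bar R}).
Import HBNNSimple.

Lemma nnsfun_tonelli2 (f : {nnsfun T1 * T2 >-> R}) :
  \int[m1 \x^ m2]_z (f z)%:E = \int[m2]_y \int[m1]_x (f (x, y))%:E.
Proof.
rewrite integralT_nnsfun sintegralE.
transitivity (\int[m2]_y \sum_(k \in range f)
    (k%:E * m1 (ysection (f @^-1` [set k]) y))).
  have k_ge0 k : range f k -> (0 <= k)%R by move=> [z _ <-]; exact: fun_ge0.
  rewrite ge0_integral_fsum//; last 2 first.
  - move=> k; apply/measurable_funeM/measurable_fun_ysection.
    exact: measurable_sfunP.
  - move=> k y _; have [k0|k0] := leP 0%R k; first by rewrite mule_ge0.
    by rewrite preimage_nnfun0// ysection0 measure0 mule0.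
  apply: eq_fsbigr => k; rewrite inE => fk.
  rewrite ge0_integralZl//; last by rewrite lee_fin k_ge0.
  by apply: measurable_fun_ysection; exact: measurable_sfunP.
apply: eq_integral => y _; have /= := sfun_fubini_tonelli_GE m1 f.
by move=> /(congr1 (fun g => g y)) <-.
Qed.

(** Tonelli's theorem for an arbitrary measure [m2], as is required by the area
    measure [hausdorff2], which is not sigma-finite on space. In the order of
    integration by which [\x^] is defined, monotone convergence reduces it to
    simple functions, and these to the definition of [\x^]. *)
Lemma ge0_tonelli2 (f : T1 * T2 -> \bar R) :
  measurable_fun setT f -> (forall z, 0 <= f z) ->
  \int[m1 \x^ m2]_z f z = \int[m2]_y \int[m1]_x f (x, y).
Proof.
move=> mf f0; pose g := nnsfun_approx measurableT mf.
have gf z : (g n z)%:E @[n --> \oo] --> f z by exact: cvg_nnsfun_approx.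
have g_mono z : {homo (fun n => (g n z)%:E) : a b / (a <= b)%N >-> a <= b}.
  by move=> a b ab; rewrite lee_fin; exact/lefP/nd_nnsfun_approx.
have mg n y : measurable_fun setT (fun x => (g n (x, y))%:E).
  exact/measurable_EFinP/measurableT_comp.
have lhs : \int[m1 \x^ m2]_z (g n z)%:E @[n --> \oo] --> \int[m1 \x^ m2]_z f z.
  rewrite (eq_integral (fun z => limn (fun n => (g n z)%:E))); last first.
    by move=> z _; apply/esym/cvg_lim => //; exact: gf.
  apply: cvg_monotone_convergence => //.
  - by move=> n; exact/measurable_EFinP.
  - by move=> n z _; rewrite lee_fin.
have inner y : \int[m1]_x (g n (x, y))%:E @[n --> \oo] --> \int[m1]_x f (x, y).
  rewrite (eq_integral (fun x => limn (fun n => (g n (x, y))%:E))); last first.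
    by move=> x _; apply/esym/cvg_lim => //; exact: gf.
  apply: cvg_monotone_convergence => //.
  by move=> n x _; rewrite lee_fin.
have rhs : \int[m2]_y \int[m1]_x (g n (x, y))%:E @[n --> \oo] -->
    \int[m2]_y \int[m1]_x f (x, y).
  rewrite (eq_integral (fun y => limn (fun n => \int[m1]_x (g n (x, y))%:E)));
    last by move=> y _; apply/esym/cvg_lim => //; exact: inner.
  apply: cvg_monotone_convergence => //.
  - move=> n; apply: (measurable_fun_fubini_tonelli_G (EFin \o g n)) => [|z].
      exact/measurable_EFinP.
    by rewrite lee_fin.
  - by move=> n y _; apply: integral_ge0 => x _; rewrite lee_fin.
  - move=> y _ a b ab; apply: ge0_le_integral => //.
    + by move=> x _; rewrite lee_fin.
    + by move=> x _; exact: g_mono.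
rewrite -(cvg_lim _ lhs)//; under eq_fun do rewrite nnsfun_tonelli2.
exact: cvg_lim.
Qed.

End tonelli.

Section product_integral.
Local Open Scope ereal_scope.
Context d1 d2 (T1 : measurableType d1) (T2 : measurableType d2) (R : realType).
Variables (m1 : {sigma_finite_measure set T1 -> \bar R}).
Variables (m2 : {measure set T2 -> \bar R}).

Lemma ge0_integral_setX (A : set T1) (B : set T2) (f : T1 -> \bar R)
    (g : T2 -> \bar R) :
  measurable A -> measurable B ->
  measurable_fun A f -> measurable_fun B g ->
  (forall x, 0 <= f x) -> (forall y, 0 <= g y) ->
  \int[m1 \x^ m2]_(z in A `*` B) (f z.1 * g z.2) =
  (\int[m1]_(x in A) f x) * (\int[m2]_(y in B) g y).
Proof.
move=> mA mB mf mg f0 g0.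
have mf' : measurable_fun setT (f \_ A) by apply/(measurable_restrictT _ mA).
have mg' : measurable_fun setT (g \_ B) by apply/(measurable_restrictT _ mB).
have f0' x : 0 <= (f \_ A) x by rewrite patchE; case: ifP.
have g0' y : 0 <= (g \_ B) y by rewrite patchE; case: ifP.
transitivity (\int[m1 \x^ m2]_z ((f \_ A) z.1 * (g \_ B) z.2)).
  rewrite integral_mkcond; apply: eq_integral => -[x y] _.
  rewrite !patchE in_setX/=.
  by case: (x \in A); case: (y \in B); rewrite ?mule0 ?mul0e.
rewrite ge0_tonelli2//; last 2 first.
- by apply: emeasurable_funM; apply: measurableT_comp.
- by move=> z; rewrite mule_ge0.
rewrite [X in X * _]integral_mkcond [X in _ * X]integral_mkcond.
rewrite -ge0_integralZl//; last exact: integral_ge0.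
by apply: eq_integral => y _; rewrite /= ge0_integralZr.
Qed.

End product_integral.

Section power_integral.
Context {R : realType} (m : R).
Hypothesis m_gt1 : 1 < m.
Let m1_gt0 : 0 < m - 1. Proof. by rewrite subr_gt0. Qed.
Let m_gt0 : 0 < m. Proof. exact: lt_trans m_gt1. Qed.

(** The truncation extends the integrand to a function continuous on the whole
    line, as the fundamental theorem of calculus is applied up to 0. *)
Lemma integral_powR_density (t : R) : 0 <= t ->
  (\int[lebesgue_measure]_(s in `[0%R, t]) (m * Num.max s 0 `^ (m - 1))%:E =
   (t `^ m)%:E)%E.
Proof.
rewrite le_eqVlt => /predU1P[<-|t0].
  by rewrite set_itv1 integral_set1 powR0 ?gt_eqF.
have cpow (q : R) : 0 < q -> continuous (fun s : R => Num.max s 0 `^ q).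
  move=> q0; apply: continuous_powR_nneg => // [z|].
    by rewrite le_max lexx orbT.
  exact: continuous_max0.
have near_max (x : R) : 0 < x -> \forall s \near x, Num.max s 0 `^ m = s `^ m.
  by move=> x0; near=> s; rewrite max_l//; apply: ltW; near: s; exact: lt_nbhsr.
rewrite (@continuous_FTC2 _ _ (fun s => Num.max s 0 `^ m) 0 t t0).
- by rewrite maxxx (max_idPl (ltW t0)) powR0 ?gt_eqF// sube0.
- by apply: continuous_subspaceT; apply: continuous_mull; exact: cpow.
- split.
  + move=> x; rewrite in_itv/= => /andP[x0 _].
    apply: (@near_eq_derivable _ _ _ (fun s => s `^ m)) => //.
      by apply: filterS (near_max x x0) => s ->.
    by apply: derivable_powR; rewrite in_itv/= x0.
  + by apply: cvg_at_right_filter; exact: cpow.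
  + by apply: cvg_at_left_filter; exact: cpow.
- move=> x; rewrite in_itv/= => /andP[x0 _].
  rewrite derive1E (@near_eq_derive _ _ _ _ (fun s => s `^ m))//; last exact: near_max.
  by rewrite -derive1E powR_derive1 ?in_itv/= ?x0// (max_idPl (ltW x0)).
Unshelve. all: by end_near. Qed.

End power_integral.

(** * The intensity measure *)

Lemma ge0_density_measure d (T : measurableType d) (R : realType)
    (mu : {measure set T -> \bar R}) (f : T -> \bar R) :
  measurable_fun setT f -> (forall x, 0 <= f x)%E ->
  exists nu : {measure set T -> \bar R},
    forall B, nu B = (\int[mu]_(x in B) f x)%E.
Proof.
move=> mf f0; pose nu B := (\int[mu]_(x in B) f x)%E.
have nu0 : nu set0 = 0%E by rewrite /nu integral_set0.
have nu_ge0 B : (0 <= nu B)%E by apply: integral_ge0.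
have nu_sigma : semi_sigma_additive nu.
  move=> F mF tF mUF; rewrite {2}/nu ge0_integral_bigcup//; last first.
    exact: measurable_funTS.
  by apply/cvg_closeP; split; [exact: is_cvg_nneseries|rewrite closeE].
pose M := isMeasure.Build d T R nu nu0 nu_ge0 nu_sigma.
by exists (HB.pack_for {measure set T -> \bar R} nu M).
Qed.

Section surface_intensity.
Context {R : realType} (mat : material R) (m : R).
Hypothesis m_gt1 : 1 < m.
Let m1_gt0 : 0 < m - 1. Proof. by rewrite subr_gt0. Qed.
Let m_gt0 : 0 < m. Proof. exact: lt_trans m_gt1. Qed.

Variables (Omega : set 'rV[R]_3) (tDu : 'rV[R]_3 -> 'M[R]_3).
Hypothesis mtDu : measurable_fun (boundary Omega) tDu.

Lemma measurable_boundary : measurable (boundary Omega).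
Proof.
apply: measurableD; last first.
  by apply: open_measurable_mx; exact: open_interior.
apply: closed_measurable_mx; exact: closed_closure.
Qed.

Definition inv_life_on_boundary : 'rV[R]_3 -> R :=
  (fun x => inv_Ndet mat (tDu x)) \_ (boundary Omega).
Local Notation h := inv_life_on_boundary.

Lemma measurable_inv_life_on_boundary : measurable_fun setT h.
Proof.
apply/(measurable_restrictT _ measurable_boundary).
exact: (measurableT_comp (measurable_inv_Ndet mat)).
Qed.

(** Extension of the surface intensity by zero from nonnegative times and
    boundary points to all of spacetime. *)
Definition weibull_density (p : @spacetime R) : R :=
  m * Num.max p.1 0 `^ (m - 1) * h p.2 `^ m.

Lemma weibull_density_ge0 p : 0 <= weibull_density p.
Proof. by rewrite /weibull_density !mulr_ge0 ?powR_ge0 ?(ltW m_gt0). Qed.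

Lemma measurable_time_density : measurable_fun setT
  (fun s : measurableTypeR R => m * Num.max s 0 `^ (m - 1)).
Proof.
apply: measurable_funM => //; apply: (measurableT_comp (measurable_powR _)).
exact: measurable_maxr.
Qed.

Lemma measurable_space_density : measurable_fun setT (fun x => h x `^ m).
Proof.
exact: (measurableT_comp (measurable_powR _) measurable_inv_life_on_boundary).
Qed.

Lemma measurable_weibull_density : measurable_fun setT weibull_density.
Proof.
apply: measurable_funM.
  by apply: (measurableT_comp measurable_time_density); exact: measurable_fst.
by apply: (measurableT_comp measurable_space_density); exact: measurable_snd.
Qed.

Lemma intensity_measureE u tu Du B :
  intensity_measure lcf_vol (lcf_sur mat m) Omega u tu Du tDu B =
  (\int[lebesgue_measure \x^ hausdorff2]_(p in B) (weibull_density p)%:E)%E.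
Proof.
rewrite /intensity_measure integral0_eq ?add0e//.
rewrite integral_mkcondr; apply: eq_integral => -[t x] _.
rewrite patchE in_setX /weibull_density/= /h patchE.
case: (boolP (t \in _)) => [|t0]; last first.
  rewrite max_r ?powR0 ?gt_eqF ?mulr0 ?mul0r//.
  move: t0; rewrite notin_setE /time_axis/= in_itv/= andbT => /negP.
  by rewrite -ltNge => /ltW.
rewrite inE /time_axis/= in_itv/= andbT => t0.
case: ifP => _; first by rewrite lcf_surE// max_l.
by rewrite powR0 ?gt_eqF// mulr0.
Qed.

Lemma integral_space_density (C : set 'rV[R]_3) :
  boundary Omega `<=` C ->
  (\int[hausdorff2]_(x in C) (h x `^ m)%:E =
   inv_Ndet_norm mat m Omega tDu `^ m)%E.
Proof.
move=> bC; rewrite /inv_Ndet_norm poweR_Lnorm ?gt_eqF//.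
rewrite [LHS]integral_mkcond; apply: eq_integral => x _.
rewrite /h !patchE; case: (boolP (x \in boundary Omega)) => [xb|_].
  rewrite Ndet_invE mem_set; last by apply: bC; exact: set_mem.
  by rewrite abse_EFin ger0_norm ?inv_Ndet_ge0// poweR_EFin.
by rewrite abse0 poweR0r ?gt_eqF// powR0 ?gt_eqF//; case: ifP.
Qed.

(** The product form of the density separates the variables, and the two factors
    are the integral of [m s^(m-1)] over [[0, t]] and the m-th power of the
    norm. All mass sits on the boundary, so [C] can be any larger set. *)
Lemma intensity_measure_slab u tu Du (C : set 'rV[R]_3) (t : R) :
  measurable C -> boundary Omega `<=` C -> 0 <= t ->
  intensity_measure lcf_vol (lcf_sur mat m) Omega u tu Du tDu
    (`[0, t] `*` C) =
  ((t `^ m)%:E * inv_Ndet_norm mat m Omega tDu `^ m)%E.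
Proof.
move=> mC bC t0; rewrite intensity_measureE.
under eq_integral do rewrite EFinM.
rewrite -integral_powR_density// -(integral_space_density bC).
apply: (@ge0_integral_setX _ _ _ _ R lebesgue_measure hausdorff2 _ _
  (fun s : measurableTypeR R => (m * Num.max s 0 `^ (m - 1))%:E)
  (fun x => (h x `^ m)%:E)) => //.
- by apply/measurable_EFinP; apply: measurable_funTS; exact: measurable_time_density.
- by apply/measurable_EFinP; apply: measurable_funTS; exact: measurable_space_density.
- by move=> s; rewrite lee_fin mulr_ge0 ?powR_ge0 ?(ltW m_gt0).
- by move=> x; rewrite lee_fin powR_ge0.
Qed.

(** A bounded set of nonnegative times is contained in some slab
    [[0, t] * R^3], whose mass is [t^m] times the m-th power of the norm. *)
Lemma radon_intensity_measure Omega_ext u tu Du :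
  (inv_Ndet_norm mat m Omega tDu < +oo)%E ->
  radon_on (crack_space Omega_ext)
    (intensity_measure lcf_vol (lcf_sur mat m) Omega u tu Du tDu).
Proof.
move=> fin; have [nu nuE] := @ge0_density_measure _ _ _
  (lebesgue_measure \x^ hausdorff2)%E (fun p => (weibull_density p)%:E)
  ((measurable_EFinP _ _).2 measurable_weibull_density) weibull_density_ge0.
have {}nuE B : intensity_measure lcf_vol (lcf_sur mat m) Omega u tu Du tDu B
    = nu B by rewrite intensity_measureE nuE.
exists nu; split=> [B _ _|B mB BC [M [_ BM]]]; first exact: nuE.
(* [BM] only bounds [B] by numbers larger than [M], whence [M + 1]. *)
pose t := Num.max (M + 1) 0.
have t0 : 0 <= t by rewrite le_max lexx orbT.
have slab := @intensity_measure_slab u tu Du setT t measurableT (@subsetT _ _) t0.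
have Bslab : B `<=` `[0, t] `*` [set: 'rV[R]_3].
  move=> p Bp; have [p0 _] := BC _ Bp; split=> //.
  move: p0; rewrite /time_axis/= !in_itv/= andbT => ->/=.
  have := BM (M + 1) _ p Bp; rewrite ltrDl => /(_ ltr01) pM.
  rewrite le_max (le_trans (ler_norm _))//.
  apply: le_trans pM; rewrite prod_normE.
  by rewrite le_max lexx.
apply: (@le_lt_trans _ _ (nu (`[0, t] `*` setT))).
  by rewrite le_measure ?inE//; exact: measurableX.
rewrite -nuE slab; apply: lte_mul_pinfty => //; first by rewrite lee_fin powR_ge0.
by rewrite poweR_lty.
Qed.

End surface_intensity.

(** * The crack initiation time *)

Lemma poisson_prob_void {R : realType} (r : R) : 0 <= r ->
  poisson_prob r 0 [set 0%N] = (expR (- r))%:E.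
Proof.
rewrite le_eqVlt => /predU1P[<-|r0]; rewrite /poisson_prob.
  by rewrite ltxx oppr0 expR0 diracE mem_set.
rewrite r0 esum_set1 ?lee_fin ?poisson_pmf_ge0//.
by rewrite /poisson_pmf r0 expr0 fact0 invr1 !mul1r.
Qed.

Section initiation_time.
Context {R : realType}.
Variables (Omega_ext : set 'rV[R]_3).
Hypothesis mOmega_ext : measurable Omega_ext.
Hypothesis bOmega_ext : bounded_set Omega_ext.

Local Notation slab := (crack_space_upto Omega_ext).

Lemma crack_space_uptoE t : slab t = `[0, t] `*` Omega_ext.
Proof.
apply/seteqP; split => -[s x] /=; rewrite /crack_space_upto /crack_space /time_axis/=.
  by move=> [[/= s0 Ox] st]; split=> //=; move: s0; rewrite !in_itv/= st => ->.
by move=> [/=]; rewrite !in_itv/= => /andP[-> ->].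
Qed.

Lemma measurable_slab t : measurable (slab t).
Proof. by rewrite crack_space_uptoE; exact: measurableX. Qed.

Lemma slab_sub t : slab t `<=` crack_space Omega_ext.
Proof. exact: subIsetl. Qed.

Lemma bounded_slab t : bounded_spacetime (slab t).
Proof.
have [M [_ bM]] := bOmega_ext; rewrite /bounded_spacetime crack_space_uptoE.
exists (Num.max M t); split=> [|N]; first exact: num_real.
rewrite gt_max => /andP[MN tN] [s x] [/=]; rewrite in_itv/= => /andP[s0 st] Ox.
rewrite prod_normE/= ge_max (bM N MN x Ox) andbT ger0_norm//.
exact: le_trans st (ltW tN).
Qed.

Lemma slab_mono s t : s <= t -> slab s `<=` slab t.
Proof. by move=> st p [Cp /= ps]; split=> //=; exact: le_trans st. Qed.

Lemma slab_bigcap t : \bigcap_n slab (t + n.+1%:R^-1) = slab t.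
Proof.
apply/seteqP; split=> p; last first.
  by move=> pt n _; apply: slab_mono pt; rewrite lerDl.
move=> pt; have [Cp _] := pt 0%N I; split=> //=.
apply/ler_addgt0Pr => e e0.
have /ltr_add_invr[n] := e0; rewrite add0r => ne.
have [_ /= pn] := pt n I; apply: le_trans pn _.
by rewrite lerD2l ltW.
Qed.

Context d (S : measurableType d) (P : probability S R)
  (gamma : S -> {measure set (@spacetime R) -> \bar R}).
Hypothesis pp : point_process (crack_space Omega_ext) gamma.

Local Notation T := (crack_initiation_time Omega_ext gamma).

Lemma slab_count t w : exists k : nat, gamma w (slab t) = k%:R%:E.
Proof.
have [_ _] := pp; apply; [exact: measurable_slab|exact: slab_sub|exact: bounded_slab].
Qed.

Lemma initiation_time_ge0 w : (0 <= T w)%E.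
Proof. by apply: le_ereal_inf_tmp => _ [t [t0 _] <-]; rewrite lee_fin ltW. Qed.

Lemma gamma_slab_mono s t w : s <= t -> (gamma w (slab s) <= gamma w (slab t))%E.
Proof.
move=> st; apply: le_measure; rewrite ?inE; [exact: measurable_slab..|].
exact: slab_mono.
Qed.

(** The infimum is attained: counts are integers, so if every slab beyond time
    [t] holds a point, then each count is at least 1, and so is their limit, the
    count of the slab at [t] (continuity from above of the finite measure
    [gamma w]). Although the infimum is over positive times, the equivalence
    holds at [t = 0], as a point at time 0 lies in all slabs. *)
Lemma initiation_time_leP t w : 0 <= t ->
  ((T w <= t%:E) <-> (0 < gamma w (slab t)))%E.
Proof.
move=> t0; split=> [Tt|gt].
  have pos n : (1 <= gamma w (slab (t + n.+1%:R^-1)))%E.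
    have : (T w < (t + n.+1%:R^-1)%:E)%E.
      by rewrite (le_lt_trans Tt)// lte_fin ltrDl invr_gt0.
    move=> /ereal_inf_lt[_ [s [s0 gs] <-]]; rewrite lte_fin => /ltW /gamma_slab_mono.
    move=> /(_ w) /(lt_le_trans gs); have [k ->] := slab_count (t + n.+1%:R^-1) w.
    by rewrite lte_fin lee_fin ltr0n ler1n.
  have cv : gamma w (slab (t + n.+1%:R^-1)) @[n --> \oo] --> gamma w (slab t).
    rewrite -slab_bigcap; apply: (@nonincreasing_cvg_mu _ _ _ (gamma w)
      (fun n => slab (t + n.+1%:R^-1))).
    - by have [k ->] := slab_count (t + 1%:R^-1) w; rewrite ltry.
    - by move=> n; exact: measurable_slab.
    - by apply: bigcap_measurable => // n _; exact: measurable_slab.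
    - move=> a b ab; apply/subsetPset; apply: slab_mono.
      by rewrite lerD2l lef_pV2 ?posrE// ler_nat.
  apply: (@lt_le_trans _ _ 1%E) => //.
  rewrite -(cvg_lim _ cv)//; apply: lime_ge; first by apply/cvg_ex; eexists; exact: cv.
  exact: nearW.
apply/lee_addgt0Pr => e e0; apply: ereal_inf_lbound; exists (t + e) => //.
split; first by rewrite ltr_wpDl.
by apply: (lt_le_trans gt); apply: gamma_slab_mono; rewrite lerDl ltW.
Qed.

Lemma initiation_time_leE t : 0 <= t ->
  [set w | (T w <= t%:E)%E] = ~` [set w | gamma w (slab t) = 0%E].
Proof.
move=> t0; apply/seteqP; split=> w /=; rewrite initiation_time_leP//.
  by move=> + g0; rewrite g0 ltxx.
by rewrite lt_neqAle measure_ge0 andbT eq_sym => /eqP.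
Qed.

Lemma measurable_slab_void t : measurable [set w | gamma w (slab t) = 0%E].
Proof.
have [mg _ _] := pp; have := mg _ (measurable_slab t).
move=> /(_ measurableT [set 0%E] (emeasurable_set1 _)); rewrite setTI.
exact.
Qed.

Lemma measurable_initiation_time_le t : measurable [set w | (T w <= t%:E)%E].
Proof.
have [t0|t0] := leP 0 t.
  by rewrite initiation_time_leE//; apply: measurableC; exact: measurable_slab_void.
rewrite (_ : [set _ | _] = set0)//; apply/seteqP; split=> // w /=.
by move=> /(le_trans (initiation_time_ge0 w)); rewrite lee_fin leNgt t0.
Qed.

Lemma measurable_initiation_time : measurable_fun setT T.
Proof.
apply: (measurability _ (ErealGenOInfty.measurableE R)) => _ [_ [r ->] <-].
rewrite setTI (_ : _ @^-1` _ = ~` [set w | (T w <= r%:E)%E]).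
  by apply: measurableC; exact: measurable_initiation_time_le.
by apply/seteqP; split=> w /=; rewrite in_itv/= andbT ltNge => /negP.
Qed.

Lemma initiation_time_cdf (rho : set (@spacetime R) -> \bar R) t :
  poisson_point_process P (crack_space Omega_ext) rho gamma ->
  0 <= t -> (0 <= rho (slab t))%E ->
  P [set w | (T w <= t%:E)%E] = (1 - expR (- fine (rho (slab t))))%:E.
Proof.
move=> [_ void _] t0 rho0; rewrite initiation_time_leE//.
rewrite probability_setC; last exact: measurable_slab_void.
have := void _ (measurable_slab t) (@slab_sub t) (bounded_slab t) 0%N.
by rewrite poisson_prob_void ?fine_ge0// => ->.
Qed.

End initiation_time.

(** A vanishing norm is the degenerate case of infinite scale, in which both
    sides are 0. *)
Lemma weibull_cdfE {R : realType} (m N t : R) : 0 < m -> 0 <= N -> 0 <= t ->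
  weibull_cdf m (N%:E)^-1%E t = 1 - expR (- (t * N) `^ m).
Proof.
move=> m0 N0; rewrite /weibull_cdf le_eqVlt => /predU1P[<-|t0].
  by rewrite ltxx mul0r powR0 ?gt_eqF// oppr0 expR0 subrr.
rewrite t0 inver; case: eqVneq => [->|_]; last by rewrite invrK.
by rewrite mulr0 powR0 ?gt_eqF// oppr0 expR0 subrr.
Qed.

Theorem proposition3p4 (R : realType) (mat : material R)
  (Omega_ext : set 'rV[R]_3) (O : set (set 'rV[R]_3))
  (GammaD GammaN : set 'rV[R]_3 -> set 'rV[R]_3)
  (Vvol Vsur : set ('rV[R]_3 -> 'rV[R]_3)) (m : R)
  (hext : measurable Omega_ext /\ bounded_set Omega_ext)
  (hO : forall Omega, O Omega ->
    bounded_lipschitz_domain Omega /\ closure Omega `<=` Omega_ext)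
  (hGamma : forall Omega, O Omega ->
    [/\ measurable (GammaD Omega), measurable (GammaN Omega),
        GammaD Omega `|` GammaN Omega = boundary Omega &
        GammaD Omega `&` GammaN Omega = set0])
  (hsol : forall f g Omega, Vvol f -> Vsur g -> O Omega ->
    unique_weak_solution mat Omega (GammaD Omega) (GammaN Omega) f g)
  (htrace : forall f g Omega u Du, Vvol f -> Vsur g -> O Omega ->
    weak_solution mat Omega (GammaD Omega) (GammaN Omega) f g u Du ->
    exists tu tDu, is_trace_mx Omega u tu /\ is_trace_mx Omega Du tDu)
  (hm : 1 < m)
  (hfin : forall f g Omega u Du tDu, Vvol f -> Vsur g -> O Omega ->
    weak_solution mat Omega (GammaD Omega) (GammaN Omega) f g u Du ->
    is_trace_mx Omega Du tDu ->
    (inv_Ndet_norm mat m Omega tDu < +oo)%E) :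
  (forall f g Omega u Du tu tDu, Vvol f -> Vsur g -> O Omega ->
    weak_solution mat Omega (GammaD Omega) (GammaN Omega) f g u Du ->
    is_trace_mx Omega u tu -> is_trace_mx Omega Du tDu ->
    local_crack_model1 Omega_ext lcf_vol (lcf_sur mat m) Omega u tu Du tDu) /\
  (zero_regular (@lcf_vol R) /\ zero_regular (lcf_sur mat m)) /\
  (forall f g Omega u Du tu tDu, Vvol f -> Vsur g -> O Omega ->
    weak_solution mat Omega (GammaD Omega) (GammaN Omega) f g u Du ->
    is_trace_mx Omega u tu -> is_trace_mx Omega Du tDu ->
    forall (d : measure_display) (S : measurableType d) (P : probability S R)
      (gamma : S -> {measure set (@spacetime R) -> \bar R}),
    poisson_point_process P (crack_space Omega_ext)
      (intensity_measure lcf_vol (lcf_sur mat m) Omega u tu Du tDu) gamma ->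
    weibull_distributed P m (inv_Ndet_norm mat m Omega tDu)^-1%E
      (crack_initiation_time Omega_ext gamma)).
Proof.
have m0 : 0 < m by exact: lt_trans hm.
have mtrace Omega (Du tDu : 'rV[R]_3 -> 'M[R]_3) :
    is_trace_mx Omega Du tDu -> measurable_fun (boundary Omega) tDu.
  by move=> tr; apply: measurable_fun_mx => i j; have [] := tr i j.
split.
  move=> f g Omega u Du tu tDu Vf Vg OO sol _ trDu; split.
  - exact: admissible_lcf_vol.
  - exact: admissible_lcf_sur.
  - apply: radon_intensity_measure => //; first exact: mtrace trDu.
    exact: hfin sol trDu.
split; first by split; [exact: zero_regular_lcf_vol|exact: zero_regular_lcf_sur].
move=> f g Omega u Du tu tDu Vf Vg OO sol _ trDu d S P gamma ppp.
have [mext bext] := hext; have [_ Oext] := hO Omega OO.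
have [pp _ _] := ppp.
have [N0 Noo] := (Lnorm_ge0 _ _ _ : (0 <= inv_Ndet_norm mat m Omega tDu)%E,
  hfin f g Omega u Du tDu Vf Vg OO sol trDu).
split; first exact: measurable_initiation_time.
move=> t; have [t0|t0] := leP 0 t; last first.
  rewrite (_ : [set _ | _] = set0) ?measure0; last first.
    apply/seteqP; split=> // w /=.
    move=> /(le_trans (initiation_time_ge0 Omega_ext gamma w)).
    by rewrite lee_fin leNgt t0.
  by rewrite /weibull_cdf ltNge (ltW t0).
have [N NE] : exists N, inv_Ndet_norm mat m Omega tDu = N%:E.
  by exists (fine (inv_Ndet_norm mat m Omega tDu)); rewrite fineK// ge0_fin_numE.
have {}N0 : 0 <= N by rewrite -lee_fin -NE.
have slabE : intensity_measure lcf_vol (lcf_sur mat m) Omega u tu Du tDu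
    (crack_space_upto Omega_ext t) = ((t * N) `^ m)%:E.
  rewrite crack_space_uptoE intensity_measure_slab//.
  - by rewrite NE poweR_EFin -EFinM powRM.
  - exact: mtrace trDu.
  - by move=> x [cx _]; exact: Oext.
rewrite (initiation_time_cdf mext bext pp ppp t0) slabE ?lee_fin ?powR_ge0//=.
by rewrite NE weibull_cdfE.
Qed.
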